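(* Let $\Phi=(\phi_n)$ be a sequence in $\mathcal H$ and let $m=(m_n)$ be a complex scalar sequence. For each $n\in\mathbb N$ let $\sqrt{m_n}$ denote one (any one) of the two complex square roots of $m_n$. Then the multiplier $M_{m,\Phi,\Phi}$ is unconditionally convergent if and only if $(\sqrt{m_n}\,\phi_n)$ is a Bessel sequence for $\mathcal H$.
   Context: $\mathcal H$ is a complex Hilbert space having an orthonormal basis $(e_n)_{n\in\mathbb N}$ indexed by $\mathbb N$; all sequences and sums are indexed by $\mathbb N$. The multiplier is $M_{m,\Phi,\Phi}f=\sum_{n=1}^\infty m_n\langle f,\phi_n\rangle\phi_n$. It is called unconditionally convergent if for every $f\in\mathcal H$ the series $\sum_n m_n\langle f,\phi_n\rangle\phi_n$ converges unconditionally (i.e. it converges for every permutation of its terms). A sequence $(\phi_n)$ in $\mathcal H$ is Bessel for $\mathcal H$ if there is $B<\infty$ with $\sum_n|\langle h,\phi_n\rangle|^2\le B\|h\|^2$ for all $h\in\mathcal H$. *)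

(* Defs.v *)
From HB Require Import structures.
From mathcomp Require Import all_boot all_order all_algebra.
From mathcomp Require Import sesquilinear complex.
From mathcomp Require Import all_classical all_reals all_analysis.

Set Implicit Arguments.
Unset Strict Implicit.
Unset Printing Implicit Defensive.

Import Order.TTheory GRing.Theory Num.Theory.
Import numFieldNormedType.Exports.

Local Open Scope classical_set_scope.
Local Open Scope ring_scope.
Local Open Scope complex_scope.

Section Hilbert.
Context {R : realType} {H : completeNormedModType R[i]}.
(* Forms of type {dot H for Num.conj} are linear in the first argument,
   conjugate-linear in the second one, hermitian and positive definite. *)
Implicit Types ip : {dot H for @Num.conj R[i]}.

(* Together with the completeness of H, this makes (H, ip) a complex Hilbert
   space whose norm and topology are the ones of H. *)
Definition induces_norm ip := forall x : H, `|x| ^+ 2 = ip x x.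

Definition orthonormal_basis ip (e : nat -> H) :=
  (forall i j, ip (e i) (e j) = (i == j)%:R) /\
  (forall f : H, series (fun n => ip f (e n) *: e n) @ \oo --> f).

Definition unconditionally_cvg (u : nat -> H) :=
  forall s : nat -> nat, bijective s -> cvgn (series (u \o s)).

Definition multiplier_term ip (m : nat -> R[i]) (phi : nat -> H) (f : H)
  (n : nat) : H := (m n * ip f (phi n)) *: phi n.

Definition multiplier_unconditionally_cvg ip (m : nat -> R[i])
  (phi : nat -> H) :=
  forall f : H, unconditionally_cvg (multiplier_term ip m phi f).

(* Norms over R[i] take their values in R[i]; being real, they are sent to R
   by complex.Re. The series is the sum in [0, +oo] of a nonnegative series. *)
Definition Bessel ip (phi : nat -> H) :=
  exists B : R, forall h : H,
    (\sum_(0 <= n <oo) (complex.Re (`|ip h (phi n)| ^+ 2))%:E <=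
     (B * complex.Re (`|h| ^+ 2))%:E)%E.

End Hilbert.

(* Main.v *)
(* Put psi n := sqrt_m n *: phi n. Pairing the n-th term of the multiplier
   series at f with f gives a scalar of modulus |<f, psi n>|^2; as unconditional
   convergence of scalar series is absolute convergence,
   \sum_n |<f, psi n>|^2 is finite for every f, and the bound is uniform in f by
   a Banach-Steinhaus argument. Conversely the n-th term is c n *: psi n with
   |c n| = |<f, psi n>|, so c is square summable, and for a Bessel sequence psi
   the norm of a finite sum of c n *: psi n is controlled by the l2 norm of c. *)
Require Import Defs.
From HB Require Import structures.
From mathcomp Require Import all_boot all_order all_algebra.
From mathcomp Require Import sesquilinear complex.
From mathcomp Require Import all_classical all_reals all_analysis.
From mathcomp Require Import ring lra.

Set Implicit Arguments.
Unset Strict Implicit.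
Unset Printing Implicit Defensive.

Import Order.TTheory GRing.Theory Num.Theory.
Import numFieldNormedType.Exports.

Local Open Scope classical_set_scope.
Local Open Scope ring_scope.
Local Open Scope complex_scope.

(** * Rearrangements of real series *)

(** Since [b] increases strictly from 0, the blocks from [b k] to [b k.+1] partition the naturals,
    so permutations of the single blocks glue into one bijection. *)
Lemma block_permutation (b : nat -> nat) (L : nat -> seq nat) :
  b 0%N = 0%N -> (forall k, b k < b k.+1)%N ->
  (forall k, perm_eq (L k) (iota (b k) (b k.+1 - b k))) ->
  exists2 s : nat -> nat, bijective s &
    forall k, map s (iota (b k) (b k.+1 - b k)) = L k.
Proof.
move=> b0 bS pL.
have bK k : (b k + (b k.+1 - b k) = b k.+1)%N by rewrite subnKC// ltnW.
have ble : {homo b : i j / (i <= j)%N}.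
  by apply: homo_leq => // [? ? ?|n]; [exact: leq_trans|exact: ltnW].
have bge k : (k <= b k)%N by elim: k => // k /leq_ltn_trans; apply.
have exK n : exists k, (n < b k.+1)%N by exists n; exact: bge.
(* [K n] is the index of the block containing [n]. Below, [s] reads [L (K n)] at the offset of [n],
   and its inverse [t] looks [n] up in that list. *)
pose K n := ex_minn (exK n).
have KP n : (b (K n) <= n < b (K n).+1)%N.
  rewrite /K; case: ex_minnP => -[|k] nk kmin; rewrite nk andbT ?b0//.
  by rewrite leqNgt; apply/negP => /kmin; rewrite ltnn.
have KE k n : (b k <= n < b k.+1)%N -> K n = k.
  case/andP=> kn nk; have /andP[Kn nK] := KP n.
  apply/eqP; rewrite eqn_leq; apply/andP; split; rewrite leqNgt; apply/negP.
    by move=> /ble/(leq_trans nk)/leq_trans/(_ Kn); rewrite ltnn.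
  by move=> /ble/(leq_trans nK)/leq_trans/(_ kn); rewrite ltnn.
have LE k n : (n \in L k) = (b k <= n < b k.+1)%N.
  by rewrite (perm_mem (pL k)) mem_iota bK.
have sL k : size (L k) = (b k.+1 - b k)%N.
  by rewrite (perm_size (pL k)) size_iota.
have uL k : uniq (L k) by rewrite (perm_uniq (pL k)) iota_uniq.
pose s n := nth 0%N (L (K n)) (n - b (K n)).
pose t n := (b (K n) + index n (L (K n)))%N.
have lt_sub n : (n - b (K n) < size (L (K n)))%N.
  by rewrite sL ltn_sub2r//; case/andP: (KP n).
have Ks n : K (s n) = K n by apply: KE; rewrite -LE mem_nth.
have inL n : n \in L (K n) by rewrite LE.
have Kt n : K (t n) = K n.
  apply: KE.
  by rewrite leq_addr -[X in (_ < X)%N]bK ltn_add2l -sL index_mem inL.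
exists s.
  exists t => n.
    by rewrite /t Ks /s index_uniq// subnKC//; case/andP: (KP n).
  by rewrite /s Kt /t addKn nth_index.
move=> k; apply: (@eq_from_nth _ 0%N); rewrite size_map size_iota ?sL// => i ik.
rewrite (nth_map 0%N) ?size_iota// nth_iota// /s.
rewrite (_ : K (b k + i)%N = k) ?addKn//; apply: KE.
by rewrite leq_addr -[X in (_ < X)%N]bK ltn_add2l.
Qed.

(* If the positive parts are not summable, cut nat into consecutive blocks in
   each of which they sum to at least 1; listing in every block the positive
   terms first breaks the Cauchy criterion. *)
Lemma cvg_series_posr (R : realType) (x : R ^nat) :
  (forall s : nat -> nat, bijective s -> cvgn (series (x \o s))) ->
  cvgn (series (fun n => Num.max (x n) 0)).
Proof.
move=> xs; apply: contrapT => ncvg.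
have xge0 n : 0 <= Num.max (x n) 0 by rewrite le_max lexx orbT.
have /choice[g gP] N : exists M, (N < M)%N /\
    1 <= \sum_(N <= n < M) Num.max (x n) 0.
  apply: contrapT => /forallNP H; apply: ncvg.
  have nd : nondecreasing_seq (series (fun n => Num.max (x n) 0)).
    exact: nondecreasing_series.
  apply: nondecreasing_is_cvgn => //.
  (* If no block starting at [N] reaches 1, every later partial sum exceeds the one at [N] by less
     than 1. *)
  exists (series (fun n => Num.max (x n) 0) N + 1) => _ [n _ <-].
  have [nN|Nn] := leqP n N.
    by rewrite (le_trans (nd _ _ nN))// lerDl.
  rewrite -lerBlDl sub_series_geq 1?ltnW//; apply: ltW.
  rewrite ltNge; apply/negP => le1.
  by apply: (H n).
pose b k := iter k g 0%N.
have bS k : (b k < b k.+1)%N by case: (gP (b k)).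
pose P n := 0 < x n.
pose I k := iota (b k) (b k.+1 - b k).
have [|k|s sbij sE] := @block_permutation b
  (fun k => seq.filter P (I k) ++ seq.filter (predC P) (I k)) _ bS.
- by [].
- by rewrite perm_filterC.
have /cauchy_cvgP/cauchy_seriesP/(_ 1 ltr01)[[A B] /= [[N _ AN] [M _ BM]] AB] :=
  xs _ sbij.
pose k := maxn N M.
have bge j : (j <= b j)%N by elim: j => // j /leq_ltn_trans; apply.
(* After rearrangement, the first [c] positions of block [k] carry exactly its positive terms. *)
pose c := count P (I k).
have cle : (c <= b k.+1 - b k)%N.
  by rewrite /c (leq_trans (count_size _ _))// size_iota.
have /AB /= : (A `*` B) (b k, b k + c)%N.
  split; [apply: AN|apply: BM] => /=.
    by rewrite (leq_trans _ (bge k))// leq_maxl.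
  by rewrite (leq_trans _ (leq_addr _ _))// (leq_trans _ (bge k))// leq_maxr.
rewrite ltNge => /negP; apply.
have -> : \sum_(b k <= n < b k + c) (x \o s) n =
    \sum_(n <- seq.filter P (I k)) x n.
  rewrite /index_iota addKn -(big_map s xpredT x); congr bigop.
  rewrite -(minn_idPl cle) -take_iota map_take sE take_size_cat//.
  by rewrite size_filter.
apply: le_trans (ler_norm _).
rewrite big_filter; have [_ /le_trans] := gP (b k); apply.
rewrite /index_iota -/(b k.+1) [leRHS]big_mkcond/=; apply: ler_sum => i _.
by rewrite /P; case: ltP => // /max_idPr xi; rewrite ?xi.
Qed.

(** The absolute value is the sum of the positive parts of [x] and of its opposite, and both
    sequences satisfy the hypothesis. *)
Lemma unconditional_normed_cvg (R : realType) (x : R ^nat) :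
  (forall s : nat -> nat, bijective s -> cvgn (series (x \o s))) ->
  cvgn [normed series x].
Proof.
move=> xs.
have xp := cvg_series_posr xs.
have xn : cvgn (series (fun n => Num.max ((\- x) n) 0)).
  by apply: cvg_series_posr => s /xs; rewrite -is_cvg_seriesN.
have -> : [normed series x] = series ((fun n => Num.max (x n) 0) +
    (fun n => Num.max ((\- x) n) 0)); last exact: is_cvg_seriesD.
congr series; apply/funext => n; rewrite !fctE /=; case: (leP (x n) 0) => xn0.
  by rewrite add0r (max_idPl _) ?oppr_ge0// ler0_norm.
by rewrite (max_idPr _) ?oppr_le0 ?ltW// addr0 gtr0_norm.
Qed.

(** * Squared moduli, Cauchy-Schwarz and continuity of the inner product *)

Lemma Re_normr_sqrK (R : realType) (V : normedZmodType R[i]) (x : V) :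
  (complex.Re (`|x| ^+ 2))%:C = `|x| ^+ 2.
Proof. by rewrite RRe_real// realX// normr_real. Qed.

Lemma Re_normr_sq_ge0 (R : realType) (V : normedZmodType R[i]) (x : V) :
  0 <= complex.Re (`|x| ^+ 2).
Proof. by rewrite -lecR Re_normr_sqrK exprn_ge0. Qed.

Lemma Re_normr_sqE (R : realType) (z : R[i]) :
  complex.Re (`|z| ^+ 2) = complex.Re z ^+ 2 + complex.Im z ^+ 2.
Proof. by rewrite -add_Re2_Im2. Qed.

Lemma Re_normr_sqZ (R : realType) (V : normedModType R[i]) (a : R[i]) (x : V) :
  complex.Re (`|a *: x| ^+ 2) = complex.Re (`|a| ^+ 2) * complex.Re (`|x| ^+ 2).
Proof.
apply: complexI; rewrite rmorphM Re_normr_sqrK normrZ exprMn.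
by congr (_ * _); rewrite -Re_normr_sqrK.
Qed.

Lemma Re_normr_le (R : realType) (z : R[i]) :
  complex.Re `|z| <= `|complex.Re z| + `|complex.Im z|.
Proof.
rewrite normc_def /= -[leRHS]ger0_norm ?addr_ge0// -sqrtr_sqr ler_wsqrtr//.
by rewrite sqrrD !real_normK ?num_real// lerD2r lerDl mulrn_wge0// mulr_ge0.
Qed.

(** Pythagoras for [x = (x - a *: y) + a *: y], where [a *: y] is the orthogonal projection of [x]
    on the line of [y]. *)
Lemma dot_CauchySchwarz (C : numClosedFieldType) (U : lmodType C)
  (ip : {dot U for @Num.conj C}) (x y : U) :
  `|ip x y| ^+ 2 <= ip x x * ip y y.
Proof.
have [->|y0] := eqVneq y 0; first by rewrite !linear0r normr0 expr0n.
have yy0 : 0 < ip y y by rewrite neq0_dnorm_gt0.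
pose a := ip x y / ip y y.
have ort : ip (x - a *: y) y = 0.
  by rewrite linearBl/= linearZl_LR /a divfK ?subrr// gt_eqF.
have -> : ip x x = ip (x - a *: y) (x - a *: y) + `|a| ^+ 2 * ip y y.
  rewrite -dnormZ -hnormDd ?subrK//.
  by rewrite linearZr_LR/= ort; exact: mulr0.
rewrite mulrDl -[leLHS]add0r lerD//.
  by rewrite mulr_ge0// ?dnorm_ge0// ltW.
rewrite /a normrM normfV (gtr0_norm yy0) exprMn exprVn expr2 -!mulrA.
by rewrite -expr2 mulVf ?mulr1// expf_neq0// gt_eqF.
Qed.

(** The scalar [c] serves both coordinates: 1 gives the real part of [ip x y], ['i] minus its
    imaginary part. *)
Lemma continuous_Re_dotl (R : realType) (H : completeNormedModType R[i])
  (ip : {dot H for @Num.conj R[i]}) (c : R[i]) (y : H) :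
  induces_norm ip -> continuous (fun x => complex.Re (c * ip x y) : R).
Proof.
move=> ipn x; apply/cvgrPdist_lt => e e0.
(* Adding 1 keeps the divisor positive when [c *: y] vanishes. *)
have cy0 : 0 < `|c *: y| + 1 by rewrite ltr_wpDl.
have e0C : 0 < e%:C / (`|c *: y| + 1) by rewrite divr_gt0// ltcR.
have /cvgrPdist_lt/(_ _ e0C) := @cvg_id H (nbhs x).
apply: filterS => t /=; rewrite ltr_pdivlMr// -raddfB/= -mulrBr -linearBl/=.
rewrite -ltcR => /(le_lt_trans _); apply; apply: le_trans (normc_ge_Re _) _.
rewrite -(@ler_pXn2r _ 2) ?nnegrE ?mulr_ge0 ?addr_ge0//.
rewrite normrM exprMn.
apply: (@le_trans _ _ (`|c| ^+ 2 * (ip (x - t) (x - t) * ip y y))).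
  by rewrite ler_wpM2l ?exprn_ge0//; exact: dot_CauchySchwarz.
rewrite mulrCA -dnormZ -!ipn -exprMn lerXn2r ?nnegrE ?mulr_ge0 ?addr_ge0//.
by rewrite ler_wpM2l// lerDl.
Qed.

(** * Baire category *)

(* The library's Baire theorem is restricted to normed modules over a realType. *)
Lemma complex_Baire (R : realType) (U : completeNormedModType R[i])
    (F : (set U)^nat) :
  (forall n, open (F n)) -> (forall n, dense (F n)) ->
  exists x, forall n, F n x.
Proof.
move=> Fo Fd.
pose B (z : U * R) := closed_ball z.1 z.2%:C.
(* One stage of the nested closed balls. When the given radius is not positive an arbitrary value is
   returned, so that the choice is total. *)
have step (na : nat * (U * R)) : exists z : U * R, 0 < na.2.2 ->
    [/\ 0 < z.2, B z `<=` ball z.1 na.1.+1%:R^-1%:C, B z `<=` B na.2 &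
        B z `<=` F na.1].
  case: na => n [a r] /=; have [r0|] := ltP 0 r; last by exists (a, r).
  have [|y [yB yF]] := Fd n (ball a r%:C) _ (ball_open _ _).
    by exists a; apply: ballxx; rewrite ltcR.
  have : nbhs y (ball a r%:C `&` F n).
    by apply: open_nbhs_nbhs; split=> //; apply: openI => //; exact: ball_open.
  move=> /nbhs_ballP[e /= e0 eB].
  have eR : (complex.Re e)%:C = e by rewrite RRe_real// gtr0_real.
  pose d := Num.min (complex.Re e) n.+1%:R^-1.
  have d0 : 0 < d by rewrite lt_min -ltcR eR e0 invr_gt0 ltr0n.
  have sub : B (y, d / 2) `<=` ball y d%:C.
    rewrite /B /= rmorphM fmorphV rmorph_nat.
    by apply: subset_closure_half; rewrite ltcR.
  have de : d%:C <= e by rewrite -eR lecR ge_min lexx.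
  exists (y, d / 2) => _; split => /=.
  - by rewrite divr_gt0.
  - by apply: (subset_trans sub); apply: le_ball; rewrite lecR ge_min lexx orbT.
  - by move=> t /sub/(le_ball de)/eB[/subset_closed_ball].
  - by move=> t /sub/(le_ball de)/eB[].
have [f fP] := choice step.
pose z := fix z n := if n is p.+1 then f (p, z p) else (0, 1).
have z0 n : 0 < (z n).2 by elim: n => //= n IH; case: (fP (n, z n) IH).
have zS n : [/\ B (z n.+1) `<=` ball (z n.+1).1 n.+1%:R^-1%:C,
    B (z n.+1) `<=` B (z n) & B (z n.+1) `<=` F n].
  by case: (fP (n, z n) (z0 n)).
have zB n m : (n <= m)%N -> B (z m) `<=` B (z n).
  elim: m => [|m IH]; first by rewrite leqn0 => /eqP ->.
  rewrite leq_eqVlt => /predU1P[->//|/IH].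
  by apply: subset_trans; case: (zS m).
have zin n : B (z n) (z n).1 by apply: closed_ballxx; rewrite ltcR.
have cz : cvgn (fun n => (z n).1).
  apply: cauchy_cvg; apply: cauchy_exP => e e0.
  have eR : (complex.Re e)%:C = e by rewrite RRe_real// gtr0_real.
  have Re0 : 0 < complex.Re e by rewrite -ltcR eR.
  have [N _ /(_ N (leqnn _)) /= Ne] := near_infty_natSinv_lt (PosNum Re0).
  exists (z N.+1).1, N.+1 => // n /= /zB /(_ _ (zin n)) zn.
  case: (zS N) => /(_ _ zn) + _ _; apply: le_ball.
  by rewrite -eR lecR ltW.
exists (limn (fun n => (z n).1)) => n.
have [_ _] := zS n; apply.
(* Each closed ball contains all later centres, hence their limit. *)
apply: (@closed_cvg _ _ \oo _ (fun n => (z n).1)) cz.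
  exact: closed_ball_closed.
by exists n.+1 => // m /= /zB; apply.
Qed.

(** * Bessel sequences: uniform bound and synthesis *)

Section BesselTheory.
Variables (R : realType) (H : completeNormedModType R[i]).
Variables (ip : {dot H for @Num.conj R[i]}) (ipn : induces_norm ip).
Implicit Types psi : nat -> H.

Local Notation energy psi N h :=
  (\sum_(0 <= n < N) complex.Re (`|ip h (psi n)| ^+ 2)).

Lemma continuous_energy psi N : continuous (fun h => energy psi N h : R).
Proof.
apply: continuous_big => [|n _]; first exact: add_continuous.
rewrite (_ : (fun h => _) = fun h => complex.Re (1 * ip h (psi n)) ^+ 2 +
    complex.Re ('i * ip h (psi n)) ^+ 2).
  by move=> h; apply: cvgD; apply: cvgM; exact: continuous_Re_dotl.
by apply/funext => h; rewrite mul1r mulrC ReiNIm sqrrN Re_normr_sqE.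
Qed.

Lemma energy_parallelogram psi N x h :
  energy psi N (x + h) + energy psi N (x - h) =
  2 * energy psi N x + 2 * energy psi N h.
Proof.
rewrite !mulr_sumr -!big_split; apply: eq_bigr => n _.
rewrite !Re_normr_sqE linearDl linearBl/=.
by move: (ip x _) (ip h _) => [a b] [c d] /=; ring.
Qed.

Lemma energyZ psi N a h :
  energy psi N (a *: h) = complex.Re (`|a| ^+ 2) * energy psi N h.
Proof.
rewrite mulr_sumr; apply: eq_bigr => n _.
have -> : ip (a *: h) (psi n) = a * ip h (psi n) by rewrite linearZl_LR.
apply: complexI; rewrite rmorphM Re_normr_sqrK normrM exprMn.
by congr (_ * _); rewrite -Re_normr_sqrK.
Qed.

(** If every [F k] were dense, Baire would give a vector with unbounded partial energies. So some
    [F k] misses a ball, on which all energies are at most [k]; recentring at 0 and scaling yield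
    the bound. *)
Lemma pointwise_energy_Bessel psi :
  (forall h, cvgn (series (fun n => complex.Re (`|ip h (psi n)| ^+ 2)))) ->
  Bessel ip psi.
Proof.
move=> cvg_psi.
pose F k := [set h | exists N, k%:R < energy psi N h].
have Fo k : open (F k).
  rewrite (_ : F k =
      \bigcup_N ((fun h => energy psi N h) @^-1` [set t | k%:R < t])).
    apply: bigcup_open => N _; apply: open_comp; last exact: open_gt.
    by move=> h _; exact: continuous_energy.
  by apply/seteqP; split => [h [N]|h [N _]]; exists N.
have [k] : exists k, ~ dense (F k).
  apply/existsNP => Fd; have [h hF] := complex_Baire Fo Fd.
  have /cvg_seq_bounded[M [_ /(_ (M + 1))]] := cvg_psi h.
  rewrite ltrDl ltr01 => /(_ erefl) hM.
  have [N] := hF (Num.truncn (M + 1)).+1.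
  apply/negP; rewrite -leNgt; apply: ltW.
  apply: le_lt_trans (truncnS_gt (M + 1)).
  by apply: le_trans (ler_norm _) (hM N _).
move=> /denseNE[G [[x /open_nbhs_nbhs/nbhs_ballP[r /= r0 xr]] G0]].
have rR : (complex.Re r)%:C = r by rewrite RRe_real// gtr0_real.
have Rr0 : 0 < complex.Re r by rewrite -ltcR rR.
(* The energy is at most k on the ball around x, hence, by the parallelogram
   identity, also on the ball of the same radius around 0. *)
have small N h : `|h| < r -> energy psi N h <= k%:R.
  move=> hr.
  have le_k y : ball x r y -> energy psi N y <= k%:R.
    move=> /xr Gy; rewrite leNgt; apply/negP => ky.
    suff : (G `&` F k) y by rewrite G0.
    by split=> //; exists N.
  have : energy psi N (x + h) + energy psi N (x - h) <= k%:R + k%:R.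
    by apply: lerD; apply: le_k; rewrite -ball_normE /=
      ?opprD ?opprK addrA subrr add0r ?normrN.
  rewrite energy_parallelogram.
  have : 0 <= energy psi N x by apply: sumr_ge0 => n _; exact: Re_normr_sq_ge0.
  lra.
(* Rescaled to norm [s], strictly below [r], a nonzero vector falls under [small]; quadratic
   homogeneity then gives the constant [k%:R / s ^+ 2]. *)
pose s := complex.Re r / 2.
have s0 : 0 < s by rewrite divr_gt0.
exists (k%:R / s ^+ 2) => h.
apply: lime_le.
  by apply: is_cvg_nneseries => n _ _; rewrite lee_fin Re_normr_sq_ge0.
apply: nearW => N; rewrite sumEFin lee_fin.
have [->|h0] := eqVneq h 0.
  rewrite big1 => [|n _]; last by rewrite linear0l normr0 expr0n.
  by rewrite normr0 expr0n mulr0.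
have nh0 : 0 < `|h| by rewrite normr_gt0.
have nhR : (complex.Re `|h|)%:C = `|h| by rewrite RRe_real// normr_real.
pose a := s%:C / `|h|.
have -> : h = a^-1 *: (a *: h).
  by rewrite scalerA mulVf ?scale1r// mulf_neq0 ?invr_eq0 ?gt_eqF ?ltcR.
have ah : `|a *: h| = s%:C.
  rewrite normrZ normrM normfV normr_id divfK ?gt_eqF// gtr0_norm//.
  by rewrite ltcR.
have Res : complex.Re (s%:C ^+ 2) = s ^+ 2 by rewrite -rmorphXn.
rewrite energyZ Re_normr_sqZ ah Res.
rewrite [leRHS]mulrCA divfK ?expf_neq0 ?gt_eqF// ler_wpM2l//.
  exact: Re_normr_sq_ge0.
by apply: small; rewrite ah -rR ltcR /s ltr_pdivrMr// ltr_pMr// ltr1n.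
Qed.

(** The Bessel bound at the sum [g] itself gives [E <= B * G]. Expanding [ip g g] bounds [G] by half
    of [B * S + B^-1 * E], and the last term is absorbed into [G]. *)
Lemma dot_sum_sq_le psi (c : nat -> R[i]) (B : R) (I : seq nat) :
  0 < B ->
  (forall h, \sum_(n <- I) complex.Re (`|ip h (psi n)| ^+ 2) <=
             B * complex.Re (`|h| ^+ 2)) ->
  complex.Re (`|\sum_(n <- I) c n *: psi n| ^+ 2) <=
  B * \sum_(n <- I) complex.Re (`|c n| ^+ 2).
Proof.
move=> B0; set g := \sum_(n <- I) c n *: psi n => /(_ g).
set G := complex.Re (`|g| ^+ 2).
set S := \sum_(n <- I) complex.Re (`|c n| ^+ 2).
set E := \sum_(n <- I) _ => EG.
(* AM-GM with weight B: 2 Re (c * conj w) <= B |c|^2 + |w|^2 / B. *)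
suff : G <= 2^-1 * (B * S + B^-1 * E).
  have : B^-1 * E <= G by rewrite ler_pdivrMl.
  lra.
have -> : G = \sum_(n <- I) complex.Re (c n * Num.conj (ip g (psi n))).
  rewrite /G ipn {1}/g linear_sumlz raddf_sum; apply: eq_bigr => n _.
  have <- : ip (psi n) g = Num.conj (ip g (psi n)).
    by rewrite hermC expr0 mul1r.
  by rewrite linearZl_LR.
rewrite !mulr_sumr -big_split mulr_sumr; apply: ler_sum => n _.
rewrite !Re_normr_sqE; move: (c n) (ip g _) => [a b] [u v] /=.
(* With [w = ip g (psi n)], the difference is the squared modulus of [B * c n - w] over [2 * B]. *)
rewrite -subr_ge0 [leRHS](_ : _ =
  (2 * B)^-1 * ((B * a - u) ^+ 2 + (B * b - v) ^+ 2)).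
  by rewrite mulr_ge0 ?addr_ge0 ?sqr_ge0// invr_ge0 mulr_ge0// ltW.
by field; rewrite gt_eqF.
Qed.

(** Compares rearranged partial sums with those in the natural order. *)
Lemma ler_sum_uniq_nat (a : R ^nat) (I : seq nat) :
  (forall n, 0 <= a n) -> uniq I -> exists n,
  \sum_(i <- I) a i <= \sum_(0 <= i < n) a i.
Proof.
move=> a0 uI; exists (\max_(i <- I) i).+1.
rewrite (perm_big [seq i <- index_iota 0 (\max_(i <- I) i).+1 | i \in I]).
  rewrite big_filter [leLHS]big_mkcond/=; apply: ler_sum => i _.
  by case: ifP.
apply: uniq_perm => // [|i]; first by rewrite filter_uniq ?iota_uniq.
rewrite mem_filter mem_index_iota ltnS/=.
by case: (boolP (i \in I)) => //= iI; rewrite (leq_bigmax_seq _ iI).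
Qed.

(** As [s] is injective, a block of rearranged indices has no repetition, so the Bessel bound holds
    over it and [dot_sum_sq_le] controls the block of vectors by its coefficients. Their squared
    moduli stay summable after rearrangement, whence the Cauchy criterion. *)
Lemma Bessel_synthesis_cvg psi (c : nat -> R[i]) (s : nat -> nat) :
  Bessel ip psi -> cvgn (series (fun n => complex.Re (`|c n| ^+ 2))) ->
  bijective s -> cvgn (series ((fun n => c n *: psi n) \o s)).
Proof.
move=> [B psiB] cc /bij_inj sinj.
(* [Bessel] permits a nonpositive [B], while [dot_sum_sq_le] needs a positive constant. *)
pose B1 := Num.max B 1.
have B10 : 0 < B1 by rewrite lt_max ltr01 orbT.
have finB (I : seq nat) h : uniq I ->
    \sum_(n <- I) complex.Re (`|ip h (psi n)| ^+ 2) <=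
    B1 * complex.Re (`|h| ^+ 2).
  move=> uI.
  have [||n /le_trans] :=
    @ler_sum_uniq_nat (fun n => complex.Re (`|ip h (psi n)| ^+ 2)) I.
  - by move=> n; exact: Re_normr_sq_ge0.
  - exact: uI.
  apply; rewrite -lee_fin.
  apply: (@le_trans _ _ (B * complex.Re (`|h| ^+ 2))%:E).
    apply: le_trans (psiB h); rewrite -sumEFin.
    apply: nneseries_lim_ge => k _ _.
    by rewrite lee_fin; exact: Re_normr_sq_ge0.
  by rewrite lee_fin ler_wpM2r ?Re_normr_sq_ge0// le_max lexx.
have u_iota n m : uniq (map s (index_iota n m)).
  by rewrite map_inj_uniq// iota_uniq.
pose a n := complex.Re (`|c n| ^+ 2).
have a0 n : 0 <= a n by exact: Re_normr_sq_ge0.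
have cas : cvgn (series (a \o s)).
  have /cvg_seq_bounded[M [_ /(_ (M + 1))]] := cc.
  rewrite ltrDl ltr01 => /(_ erefl) hM.
  apply: nondecreasing_is_cvgn.
    by apply: nondecreasing_series => n _ _; exact: a0.
  exists (M + 1) => _ [n _ <-].
  rewrite /series/= -(big_map s xpredT a).
  have [N /le_trans] := ler_sum_uniq_nat a0 (u_iota 0%N n); apply.
  by apply: le_trans (ler_norm _) (hM N _).
apply/cauchy_cvgP/cauchy_seriesP => e e0.
have eR : (complex.Re e)%:C = e by rewrite RRe_real// gtr0_real.
have Re0 : 0 < complex.Re e by rewrite -ltcR eR.
have d0 : 0 < complex.Re e ^+ 2 / B1 by rewrite divr_gt0// exprn_gt0.
have /cauchy_cvgP/cauchy_seriesP/(_ _ d0) := cas.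
apply: filterS => -[n m] /= /(le_lt_trans (ler_norm _)).
rewrite ltr_pdivlMr// mulrC -(big_map s xpredT a) => lt_e.
rewrite -(big_map s xpredT (fun n => c n *: psi n)).
rewrite -(@ltr_pXn2r _ 2) ?nnegrE ?normr_ge0 ?ltW//.
rewrite -Re_normr_sqrK -eR -rmorphXn ltcR; apply: le_lt_trans lt_e.
by apply: dot_sum_sq_le => // h; exact: finB.
Qed.

End BesselTheory.

(** * Unconditional convergence of multipliers and the Bessel property *)

Theorem proposition4p1 (R : realType) (H : completeNormedModType R[i])
  (ip : {dot H for @Num.conj R[i]}) (ip_norm : induces_norm ip)
  (e : nat -> H) (e_basis : orthonormal_basis ip e)
  (phi : nat -> H) (m sqrt_m : nat -> R[i])
  (sqrt_mE : forall n : nat, sqrt_m n ^+ 2 = m n) :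
  multiplier_unconditionally_cvg ip m phi <->
  Bessel ip (fun n : nat => sqrt_m n *: phi n).
Proof.
(* The conjugate of [sqrt_m n] coming from the second argument disappears in the modulus. *)
have ipr f n : `|ip f (sqrt_m n *: phi n)| = `|sqrt_m n * ip f (phi n)|.
  by rewrite linearZr_LR /= !normrM norm_conjC.
split=> [uc|Bpsi f s sbij].
  apply: pointwise_energy_Bessel => // f.
  pose z n := ip (multiplier_term ip m phi f n) f.
  have zE n : `|z n| = `|ip f (sqrt_m n *: phi n)| ^+ 2.
    rewrite ipr /z /multiplier_term linearZl_LR hermC expr0 mul1r /= -sqrt_mE.
    by rewrite !normrM norm_conjC; ring.
  have zle n : complex.Re (`|ip f (sqrt_m n *: phi n)| ^+ 2) <=
      `|complex.Re (1 * z n)| + `|complex.Re ('i * z n)|.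
    rewrite -zE mul1r [X in _ + `|complex.Re X|]mulrC ReiNIm normrN.
    exact: Re_normr_le.
  (* Continuity of [ip _ f] carries convergence of each rearranged vector series to the real and
     imaginary parts of [z], taken at [c = 1] and [c = 'i]. *)
  have cz (c : R[i]) : cvgn [normed series (fun n => complex.Re (c * z n))].
    apply: unconditional_normed_cvg => s /(uc f) cvg_s.
    have -> : series ((fun n => complex.Re (c * z n)) \o s) =
        (fun h => complex.Re (c * ip h f)) \o
        series (multiplier_term ip m phi f \o s).
      apply/funext => n /=.
      by rewrite /series /= linear_sumlz mulr_sumr raddf_sum.
    apply: cvgP.
    apply: continuous_cvg cvg_s.
    exact: continuous_Re_dotl.
  apply: series_le_cvg (is_cvg_seriesD (cz 1) (cz 'i)) => n.
  - exact: Re_normr_sq_ge0.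
  - exact: (addr_ge0 (normr_ge0 _) (normr_ge0 _)).
  - exact: zle.
(* Of the two factors [sqrt_m n] of [m n], one joins the coefficient and the other the vector. *)
have -> : multiplier_term ip m phi f =
    (fun n => (sqrt_m n * ip f (phi n)) *: (sqrt_m n *: phi n)).
  apply/funext => n; rewrite /multiplier_term scalerA -sqrt_mE.
  by congr (_ *: _); ring.
apply: (Bessel_synthesis_cvg ip_norm Bpsi _ sbij).
case: Bpsi => B /(_ f) fB.
apply: nondecreasing_is_cvgn.
  by apply: nondecreasing_series => n _ _; exact: Re_normr_sq_ge0.
exists (B * complex.Re (`|f| ^+ 2)) => _ [n _ <-].
rewrite -lee_fin; apply: le_trans fB.
rewrite (_ : series _ n = \sum_(0 <= k < n)
  complex.Re (`|ip f (sqrt_m k *: phi k)| ^+ 2)).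
  rewrite -sumEFin.
  by apply: nneseries_lim_ge => k _ _; rewrite lee_fin; exact: Re_normr_sq_ge0.
by apply: eq_bigr => k _; rewrite ipr.
Qed.
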